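(* If $\mathfrak{g}$ is a Hilbert–Lie algebra, then each non-empty open invariant convex subset $\Omega\subseteq\mathfrak{g}$ intersects the center $\mathfrak{z}(\mathfrak{g})$.
   Context: A Hilbert–Lie algebra is a real Lie algebra $\mathfrak{g}$ with continuous Lie bracket, endowed with a positive definite symmetric bilinear form $\kappa$ which is invariant, i.e. $\kappa([x,y],z)=\kappa(x,[y,z])$ for all $x,y,z$, such that $(\mathfrak{g},\kappa)$ is complete (a real Hilbert space); the topology is the Hilbert space topology. A subset is invariant if it is invariant under the group of inner automorphisms generated by all $e^{\mathrm{ad}\,x}$, $x\in\mathfrak{g}$. *)

(* Defs.v *)
From HB Require Import structures.
From mathcomp Require Import all_boot all_order all_algebra.
From mathcomp Require Import all_classical all_reals all_analysis.

Set Implicit Arguments.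
Unset Strict Implicit.
Unset Printing Implicit Defensive.

Import Order.TTheory GRing.Theory Num.Theory.
Import numFieldNormedType.Exports.

Local Open Scope classical_set_scope.
Local Open Scope ring_scope.

(* [norm_kappa] says that the norm of the complete normed space [g] is the one
   defined by [kappa]; hence the topology of [g] is the Hilbert space topology
   and the completeness of [g] is that of (g, kappa). *)
HB.mixin Record isHilbertLie (R : realType) (g : Type)
    of CompleteNormedModule R g := {
  bracket : g -> g -> g ;
  bracket_bilinear : bilinear_for *:%R *:%R bracket ;
  bracket_alt : forall x : g, bracket x x = 0 ;
  bracket_jacobi : forall x y z : g,
    bracket x (bracket y z) + bracket y (bracket z x)
      + bracket z (bracket x y) = 0 ;
  bracket_continuous : continuous (fun p : g * g => bracket p.1 p.2) ;
  kappa : g -> g -> R ;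
  kappa_bilinear : bilinear_for *%R *%R kappa ;
  kappa_sym : forall x y : g, kappa x y = kappa y x ;
  kappa_gt0 : forall x : g, x != 0 -> 0 < kappa x x ;
  kappa_invariant : forall x y z : g,
    kappa (bracket x y) z = kappa x (bracket y z) ;
  norm_kappa : forall x : g, `|x| ^+ 2 = kappa x x
}.

#[short(type="hilbertLieType")]
HB.structure Definition HilbertLie (R : realType) :=
  {g of CompleteNormedModule R g & isHilbertLie R g}.

HB.instance Definition _ (R : realType) (g : hilbertLieType R) :=
  bilinear_isBilinear.Build R g g g *:%R *:%R (@bracket R g) bracket_bilinear.

HB.instance Definition _ (R : realType) (g : hilbertLieType R) :=
  bilinear_isBilinear.Build R g g R *%R *%R (@kappa R g) kappa_bilinear.

Definition ad (R : realType) (g : hilbertLieType R) (x : g) : g -> g :=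
  fun y => bracket x y.

Definition exp_ad (R : realType) (g : hilbertLieType R) (x : g) : g -> g :=
  fun y => lim (series (fun n => n`!%:R^-1 *: iter n (ad x) y) @ \oo).

(* The group of transformations of [g] generated by the [exp_ad x]. *)
Inductive inner_aut (R : realType) (g : hilbertLieType R) : (g -> g) -> Prop :=
| inner_aut_exp (x : g) : inner_aut (exp_ad x)
| inner_aut_id : inner_aut idfun
| inner_aut_comp (f h : g -> g) :
    inner_aut f -> inner_aut h -> inner_aut (f \o h)
| inner_aut_inv (f h : g -> g) :
    inner_aut f -> cancel f h -> cancel h f -> inner_aut h.

Definition inner_invariant (R : realType) (g : hilbertLieType R) (A : set g) :=
  forall f : g -> g, inner_aut f -> f @` A `<=` A.

Definition lie_center (R : realType) (g : hilbertLieType R) : set g :=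
  [set z | forall x : g, bracket z x = 0].
Arguments lie_center {R} g _.

(* Main.v *)
Require Import Defs.
From HB Require Import structures.
From mathcomp Require Import all_boot all_order all_algebra.
From mathcomp Require Import all_classical all_reals all_analysis.
From mathcomp Require Import ring lra.
Import Order.TTheory GRing.Theory Num.Theory.
Import numFieldNormedType.Exports.
Local Open Scope classical_set_scope.
Local Open Scope ring_scope.

(** The Bruhat-Tits fixed point argument proves the theorem. For [e > 0], erode
    [Omega] to the set [C] of the centres of the [e]-balls contained in
    [Omega]. Since [Omega] is open, [C] is non-empty for small [e]; it is
    closed, whereas [Omega] need not be, and it inherits midpoint convexity
    from [Omega]. In a Hilbert space such a set has exactly one element [z] of
    minimal norm ([closed_min_norm_exists] and [min_norm_unique], both from the
    parallelogram law). The transformations [exp_ad x] are bijective isometries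
    that preserve [Omega], so they permute the [e]-balls in [Omega] and preserve
    [C]; they also preserve norms, so they fix [z] by uniqueness. A point fixed
    by every [exp_ad x] is central, and [z] lies in [C], hence in [Omega].

    What this needs about the exponential of a bounded operator [A] comes from
    its partial sums [S_N]. The product [S_N(A) (S_N(-A) y)] tends to [y]
    ([cvg_series_exp_term_opp]): by the binomial formula the terms of total
    degree below [N] add up to [y], and the remaining ones are dominated by the
    same terms for a scalar bound [a] of [A], that is by
    [S_N(a)^2 - S_N(2a)], which tends to [e^a e^a - e^(2a) = 0]. As [ad x] is
    skew for [kappa], [kappa (S_N(ad x) u) (S_N(ad x) v)] equals
    [kappa u (S_N(- ad x) (S_N(ad x) v))], so [exp_ad x] preserves [kappa]
    ([kappa_exp_ad_isometry]); being also the adjoint of [exp_ad (- x)], it is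
    inverse to it ([exp_adK]). Finally, if [A] has norm at most [1/2] and
    [e^A y = y], then [A y = - (A^2 y / 2! + A^3 y / 3! + ...)] has norm at most
    [|A y| / 2], so [A y = 0] ([exp_fixed_ker]). *)

(** * Products of truncated exponential series *)

Lemma big_triangle (W : zmodType) (N : nat) (F : nat -> nat -> W) :
  \sum_(0 <= i < N) \sum_(0 <= j < N - i) F i j =
  \sum_(0 <= k < N) \sum_(0 <= i < k.+1) F i (k - i)%N.
Proof.
transitivity (\sum_(0 <= i < N) \sum_(0 <= k < N | (i <= k)%N) F i (k - i)%N).
  apply: eq_big_nat => i /andP[_ iN].
  rewrite [RHS](big_cat_nat _ (ltnW iN))//= [X in _ = X + _]big1_seq ?add0r.
    rewrite [RHS](_ : _ = \sum_(0 + i <= k < N | (i <= k)%N) F i (k - i)%N)//.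
    rewrite big_addn [RHS]big_mkcond /=.
    by apply: eq_bigr => j _; rewrite leq_addl addnK.
  by move=> k /andP[ik]; rewrite mem_index_iota /= ltnNge ik.
rewrite (exchange_big_dep_nat xpredT)//=.
apply: eq_big_nat => k /andP[_ kN].
rewrite (big_cat_nat _ kN)//= [X in _ + X = _]big1_seq ?addr0.
  rewrite big_mkcond; apply: eq_big_nat => i /andP[_].
  by rewrite ltnS => ->.
by move=> i /andP[ik]; rewrite mem_index_iota /= ltnNge ik.
Qed.

Lemma exp_coeff_binomial (R : realType) (s t : R) (k : nat) :
  \sum_(0 <= i < k.+1) exp_coeff s i * exp_coeff t (k - i)%N =
  exp_coeff (s + t) k.
Proof.
rewrite /exp_coeff /= (addrC s) exprDn mulr_suml big_mkord.
apply: eq_bigr => i _; have ik : (i <= k)%N by rewrite -ltnS.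
have k0 : k`!%:R != 0 :> R by rewrite pnatr_eq0 -lt0n fact_gt0.
have i0 : i`!%:R != 0 :> R by rewrite pnatr_eq0 -lt0n fact_gt0.
have ki0 : (k - i)`!%:R != 0 :> R by rewrite pnatr_eq0 -lt0n fact_gt0.
rewrite -mulr_natr -{1}(bin_fact ik) !natrM.
have b0 : 'C(k, i)%:R != 0 :> R by rewrite pnatr_eq0 -lt0n bin_gt0.
by field; rewrite i0 ki0 b0.
Qed.

(** The vectors [w k] stand for the powers of an operator applied to a fixed
    vector; with [W] the scalar line they recover the scalar identity. *)
Lemma exp_coeff_triangle (R : realType) (W : lmodType R) (s t : R)
    (w : nat -> W) (N : nat) :
  \sum_(0 <= i < N) \sum_(0 <= j < N - i)
     (exp_coeff s i * exp_coeff t j) *: w (i + j)%N =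
  \sum_(0 <= k < N) exp_coeff (s + t) k *: w k.
Proof.
rewrite (big_triangle _ _
  (fun i j => (exp_coeff s i * exp_coeff t j) *: w (i + j)%N)).
apply: eq_bigr => k _; rewrite -exp_coeff_binomial scaler_suml.
by apply: eq_big_nat => i /andP[_]; rewrite ltnS => ik; rewrite subnKC.
Qed.

(** The part of the square of a truncated exponential series beyond the
    truncation degree; it is what a product of two such series loses when it is
    compared with the truncated series of the sum. *)
Lemma exp_coeff_corner (R : realType) (a : R) (N : nat) :
  \sum_(0 <= i < N) \sum_(N - i <= j < N) exp_coeff a i * exp_coeff a j =
  series (exp_coeff a) N ^+ 2 - series (exp_coeff (a + a)) N.
Proof.
have := @exp_coeff_triangle R R^o a a (fun=> 1) N.
rewrite /series /= => T.
rewrite expr2 mulr_suml.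
under [X in X - _]eq_bigr do rewrite mulr_sumr.
under [X in X - _]eq_bigr => i _ do rewrite (big_cat_nat _ (leq_subr i N))//=.
rewrite big_split /= [X in _ - X](_ : _ =
    \sum_(0 <= i < N) \sum_(0 <= j < N - i) exp_coeff a i * exp_coeff a j).
  by rewrite addrAC subrr add0r.
transitivity (\sum_(0 <= k < N) exp_coeff (a + a) k *: (1 : R^o)).
  by apply: eq_bigr => k _; rewrite [_ *: _]mulr1.
rewrite -T; apply: eq_bigr => i _; apply: eq_bigr => j _.
by rewrite [_ *: _]mulr1.
Qed.

(** * The exponential of a bounded operator *)

Definition exp_term {R : realType} {V : completeNormedModType R}
  (f : V -> V) (y : V) : nat -> V := fun n => n`!%:R^-1 *: iter n f y.

Section operator_exponential.
Variables (R : realType) (V : completeNormedModType R) (A : {linear V -> V}).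
Variable a : R.
Hypothesis A_le : forall v, `|A v| <= a * `|v|.
Hypothesis a_ge0 : 0 <= a.

Lemma iter_norm_le n y : `|iter n A y| <= a ^+ n * `|y|.
Proof.
elim: n => [|n IH]; first by rewrite expr0 mul1r.
by rewrite iterS exprS -mulrA (le_trans (A_le _))// ler_wpM2l.
Qed.

Lemma exp_term_norm_le y n : `|exp_term A y n| <= exp_coeff a n * `|y|.
Proof.
rewrite /exp_term /exp_coeff /= normrZ ger0_norm ?invr_ge0//.
by rewrite mulrAC mulrC ler_wpM2r ?invr_ge0// iter_norm_le.
Qed.

Lemma is_cvg_series_exp_term y : cvgn (series (exp_term A y)).
Proof.
apply: normed_cvg; apply: (@series_le_cvg _ _ (fun n => `|y| * exp_coeff a n)).
- by move=> n /=.
- by move=> n; rewrite mulr_ge0// exp_coeff_ge0.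
- by move=> n /=; rewrite mulrC exp_term_norm_le.
- have -> : (fun n => `|y| * exp_coeff a n) = `|y| *: exp_coeff a.
    by apply/funext.
  by apply: is_cvg_seriesZ; exact: is_cvg_series_exp_coeff.
Qed.

Lemma iter_linear_sum n (N : nat) (c : nat -> R) (v : nat -> V) :
  iter n A (\sum_(0 <= i < N) c i *: v i) =
  \sum_(0 <= i < N) c i *: iter n A (v i).
Proof.
elim: n => //= n ->; rewrite linear_sum; apply: eq_bigr => i _.
by rewrite linearZ.
Qed.

(** The identity [e^A e^(-A) = 1], kept at the level of partial sums so that no
    exchange of two limits is involved. [B] is left arbitrary to cover functions
    that are pointwise, though not by definition, equal to [- A]. *)
Lemma cvg_series_exp_term_opp (B : V -> V) y : (forall v, B v = - A v) ->
  series (exp_term A (series (exp_term B y) N)) N @[N --> \oo] --> y.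
Proof.
move=> BA.
have BE n : exp_term B y n = exp_coeff (- 1) n *: iter n A y.
  rewrite /exp_term /exp_coeff /= mulrC -scalerA; congr (_ *: _).
  elim: n => [|n IH]; first by rewrite scale1r.
  by rewrite !iterS IH BA linearZ exprS mulN1r scaleNr.
have prodE N : series (exp_term A (series (exp_term B y) N)) N =
    \sum_(0 <= i < N) \sum_(0 <= j < N)
      (exp_coeff 1 i * exp_coeff (-1) j) *: iter (i + j) A y.
  rewrite /series /=; apply: eq_bigr => i _.
  rewrite {1}/exp_term; under [X in iter i A X]eq_bigr do rewrite BE.
  rewrite iter_linear_sum scaler_sumr; apply: eq_bigr => j _.
  by rewrite scalerA iterD {2}/exp_coeff /= expr1n mul1r.
(* The triangle [i + j <= N] collapses to [y], as it is the truncated series of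
   the exponent [1 - 1 = 0]; the corner is left. *)
have prodN N : series (exp_term A (series (exp_term B y) N.+1)) N.+1 = y +
    \sum_(0 <= i < N.+1) \sum_(N.+1 - i <= j < N.+1)
      (exp_coeff 1 i * exp_coeff (-1) j) *: iter (i + j) A y.
  rewrite prodE.
  under eq_bigr => i _ do rewrite (big_cat_nat _ (leq_subr i N.+1))//=.
  rewrite big_split /= exp_coeff_triangle; congr (_ + _).
  rewrite big_nat_recl//= big1 ?addr0.
    by rewrite subrr /exp_coeff /= expr0 fact0 invr1 mul1r scale1r.
  by move=> k _; rewrite subrr /exp_coeff /= expr0n mul0r scale0r.
apply/subr_cvg0; apply: norm_cvg0.
pose err N := (series (exp_coeff a) N ^+ 2 - series (exp_coeff (a + a)) N) * `|y|.
apply: (@squeeze_cvgr _ _ _ _ (fun=> 0) err).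
- exists 1%N => // -[//|N _]; rewrite /= normr_ge0 /= prodN addrC addKr.
  rewrite /err -exp_coeff_corner mulr_suml (le_trans (ler_norm_sum _ _ _))//.
  apply: ler_sum => i _; rewrite mulr_suml (le_trans (ler_norm_sum _ _ _))//.
  apply: ler_sum => j _; rewrite normrZ normrM.
  rewrite /exp_coeff /= !normrM !normrX normrN normr1 !expr1n !mul1r.
  rewrite !ger0_norm ?invr_ge0// mulrACA -exprD.
  by rewrite [leRHS]mulrAC [leRHS]mulrC ler_wpM2l ?mulr_ge0 ?invr_ge0// iter_norm_le.
- exact: cvg_cst.
- rewrite -(mul0r `|y|); apply: cvgM; last exact: cvg_cst.
  rewrite -(subrr (expR (a + a))); apply: cvgB; last exact: is_cvg_series_exp_coeff.
  rewrite expRD; under eq_fun do rewrite expr2.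
  by apply: cvgM; exact: is_cvg_series_exp_coeff.
Qed.

(** The tail [A^2 y / 2! + A^3 y / 3! + ...] is dominated by [|A y|] times the
    geometric series [1/4 + 1/8 + ...]: a fixed vector satisfies
    [|A y| <= |A y| / 2]. *)
Lemma exp_fixed_ker y : a <= 2^-1 -> limn (series (exp_term A y)) = y -> A y = 0.
Proof.
move=> a2 fix_y.
have half n : `|\sum_(0 <= i < n) exp_term A y i.+2| <=
    (2^-1 - 2^-1 ^+ n.+1) * `|A y|.
  elim: n => [|n IH]; first by rewrite big_nil normr0 expr1 subrr mul0r.
  rewrite big_nat_recr//= (le_trans (ler_normD _ _))//.
  have : `|exp_term A y n.+2| <= 2^-1 ^+ n.+2 * `|A y|.
    rewrite /exp_term normrZ ger0_norm ?invr_ge0//.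
    (* One factor [1/2] comes from the factorial, the others from [A]. *)
    rewrite [iter _ _ _]iterSr exprS -mulrA.
    apply: ler_pM; rewrite ?invr_ge0//.
      rewrite lef_pV2 ?posrE ?ltr0n ?fact_gt0// ler_nat.
      exact: (@leq_fact 2 n.+2).
    apply: (le_trans (iter_norm_le _ _)); rewrite ler_wpM2r//.
    by rewrite lerXn2r ?nnegrE ?invr_ge0.
  rewrite exprS; move: IH; set x := \sum_(_ <= _ < _) _; set z := 2^-1 ^+ n.+1 .
  move: `|x| `|exp_term A y n.+2| `|A y| => *; nra.
have S2 : (fun n => series (exp_term A y) n.+2 - y - A y) @ \oo --> - A y.
  rewrite -[X in _ --> X]add0r -[X in _ --> X - _](subrr y).
  apply: cvgB; last exact: cvg_cst.
  apply: cvgB; last exact: cvg_cst.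
  rewrite -[X in _ --> X]fix_y.
  rewrite (_ : (fun n => _) = (fun n => series (exp_term A y) (n + 2)%N));
    last first.
    by apply/funext => n; rewrite addn2.
  by rewrite cvg_shiftn; exact: is_cvg_series_exp_term.
have : `|- A y| <= 2^-1 * `|A y|.
  apply: (cvgr_to_le (cvg_norm S2)); near=> n.
  rewrite /series /= !big_nat_recl//= {1 2}/exp_term /= fact0 invr1 !scale1r.
  rewrite (addrC y) addrK (addrC (A y)) addrK.
  apply: le_trans (half n) _.
  by rewrite ler_wpM2r// lerBlDr lerDl exprn_ge0 ?invr_ge0.
rewrite normrN => h; apply/eqP; rewrite -normr_eq0 eq_le normr_ge0 andbT; lra.
Unshelve. all: by end_near. Qed.

End operator_exponential.

(** * Elements of minimal norm *)

Section min_norm.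
Variables (R : realType) (V : completeNormedModType R).
Hypothesis parallelogram : forall u v : V,
  `|u + v| ^+ 2 + `|u - v| ^+ 2 = 2 * `|u| ^+ 2 + 2 * `|v| ^+ 2.
Variable C : set V.
Hypothesis C_mid : forall u v, C u -> C v -> C (2^-1 *: (u + v)).

(** By the parallelogram law, two almost minimal vectors are close to each other,
    because their midpoint cannot be shorter than the minimum. This quantitative
    form gives both the uniqueness and the Cauchy property of minimizing
    sequences. *)
Lemma dist_near_min_norm (m d e : R) (u v : V) :
  (forall c, C c -> m <= `|c| ^+ 2) -> C u -> C v ->
  `|u| ^+ 2 <= m + d -> `|v| ^+ 2 <= m + e -> `|u - v| ^+ 2 <= 2 * d + 2 * e.
Proof.
move=> mle Cu Cv ud ve.
have := mle _ (C_mid _ _ Cu Cv).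
rewrite normrZ exprMn ger0_norm ?invr_ge0// => mid.
have := parallelogram u v.
move: mid ud ve; set a := `|u + v| ^+ 2; set b := `|u - v| ^+ 2.
by move=> *; lra.
Qed.

Lemma min_norm_unique (u v : V) : C u -> C v ->
  (forall c, C c -> `|u| <= `|c|) -> `|v| = `|u| -> u = v.
Proof.
move=> Cu Cv umin vu.
have := @dist_near_min_norm (`|u| ^+ 2) 0 0 u v _ Cu Cv.
rewrite vu addr0 mulr0 addr0 => /(_ _ (lexx _) (lexx _)) uv0.
apply/eqP; rewrite -subr_eq0 -normr_eq0 -sqrf_eq0 eq_le sqr_ge0 uv0//.
by move=> c Cc; rewrite ler_sqr ?nnegrE// umin.
Qed.

Lemma closed_min_norm_exists : closed C -> C !=set0 ->
  exists2 z, C z & forall c, C c -> `|z| <= `|c|.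
Proof.
move=> Ccl [c0 Cc0].
pose E := [set `|c| ^+ 2 | c in C].
have Einf : has_inf E.
  split; first by exists (`|c0| ^+ 2), c0.
  by exists 0 => _ [c _ <-]; exact: sqr_ge0.
pose m := inf E.
have mle c : C c -> m <= `|c| ^+ 2.
  by move=> Cc; apply: ge_inf; [exact: Einf.2|exists c].
have /choice[u uP] n : exists c, C c /\ `|c| ^+ 2 <= m + n.+1%:R^-1.
  have [|_ [c Cc <-] cm] := @inf_adherent R E n.+1%:R^-1 _ Einf.
    by rewrite invr_gt0.
  by exists c; split => //; exact: ltW.
have u_cvg : cvgn u.
  apply: cauchy_cvg; apply: cauchy_exP => e e0.
  have e2 : 0 < e ^+ 2 / 4 by rewrite divr_gt0 ?exprn_gt0.
  have [N _ NP] := near_infty_natSinv_lt (PosNum e2).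
  exists (u N), N => // n /= Nn; rewrite -ball_normE /=.
  rewrite -ltr_sqr ?nnegrE ?(ltW e0)//.
  apply: le_lt_trans (dist_near_min_norm _ _ _ _ _ mle
    (uP N).1 (uP n).1 (uP N).2 (uP n).2) _.
  have := NP _ (leqnn N); have := NP _ Nn => /=.
  by move: (n.+1%:R^-1) (N.+1%:R^-1) => x y; lra.
pose z := limn u.
have Cz : C z.
  by apply: (closed_cvg _ Ccl _ _ u_cvg); near=> n; exact: (uP n).1.
exists z => // c Cc; rewrite -ler_sqr ?nnegrE//.
apply: le_trans (mle c Cc).
rewrite -[m in leRHS]addr0.
have zn : (fun n => `|u n| ^+ 2) @ \oo --> `|z| ^+ 2.
  by under eq_fun do rewrite expr2; rewrite expr2; apply: cvgM; exact: cvg_norm.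
have mn : (fun n => m + n.+1%:R^-1) @ \oo --> m + 0.
  by apply: cvgD; [exact: cvg_cst|exact: cvg_harmonic].
by apply: (ler_cvg_to zn mn); near=> n; exact: (uP n).2.
Unshelve. all: by end_near. Qed.

End min_norm.

(** * Inner automorphisms of a Hilbert-Lie algebra *)

Section hilbert_lie.
Variables (R : realType) (g : hilbertLieType R).
Implicit Types (x y z u v w c : g) (Omega : set g).

Lemma hilbert_parallelogram u v :
  `|u + v| ^+ 2 + `|u - v| ^+ 2 = 2 * `|u| ^+ 2 + 2 * `|v| ^+ 2.
Proof.
rewrite !norm_kappa !linearDl !linearDr !linearNl !linearNr /=.
by ring.
Qed.

Lemma sqr_norm_sub u v : `|u - v| ^+ 2 = kappa u u - 2 * kappa u v + kappa v v.
Proof.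
rewrite norm_kappa linearBl !linearBr /= (kappa_sym v u); by ring.
Qed.

(** Polarization, from which the continuity of [kappa] follows. *)
Lemma kappa_polar u v :
  kappa u v = 2^-1 * (`|u + v| ^+ 2 - `|u| ^+ 2 - `|v| ^+ 2).
Proof.
by rewrite !norm_kappa linearDl !linearDr /= (kappa_sym v u); field.
Qed.

Lemma cvg_kappa (u v : nat -> g) (k l : g) : u @ \oo --> k -> v @ \oo --> l ->
  kappa (u n) (v n) @[n --> \oo] --> kappa k l.
Proof.
move=> uk vl; rewrite kappa_polar; under eq_fun do rewrite kappa_polar.
have sq (f : nat -> g) (l' : g) : f @ \oo --> l' ->
    (fun n => `|f n| ^+ 2) @ \oo --> `|l'| ^+ 2.
  by move=> fl; under eq_fun do rewrite expr2; rewrite expr2; apply: cvgM;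
    exact: cvg_norm.
apply: cvgM; first exact: cvg_cst.
by apply: cvgB; [apply: cvgB|]; apply: sq => //; exact: cvgD.
Qed.

Lemma ad_linear x : linear (ad x).
Proof. by move=> c u v; rewrite /ad linearPr. Qed.

HB.instance Definition _ x := GRing.isLinear.Build R g g *:%R (ad x) (ad_linear x).

Lemma adN x v : ad (- x) v = - ad x v.
Proof. by rewrite /ad linearNl. Qed.

Lemma ad_bounded x : exists2 a, 0 <= a & forall v, `|ad x v| <= a * `|v|.
Proof.
have [k k0 kP] := bilinear_schwarz (@bracket_continuous R g).
by exists (k * `|x|) => [|v]; [rewrite mulr_ge0// ltW|exact: kP].
Qed.

Lemma cvg_exp_ad x y : series (exp_term (ad x) y) @ \oo --> exp_ad x y.
Proof.
by have [a a0 aP] := ad_bounded x; exact: is_cvg_series_exp_term aP a0 y.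
Qed.

Lemma kappa_ad x u v : kappa (ad x u) v = kappa u (ad (- x) v).
Proof.
rewrite adN linearNr /= /ad -kappa_invariant -linearNl /=; congr kappa.
apply/eqP; rewrite -subr_eq0 opprK.
have := bracket_alt (x + u).
by rewrite linearDl !linearDr /= !bracket_alt add0r addr0 => ->.
Qed.

Lemma kappa_exp_partial x u v n :
  kappa (series (exp_term (ad x) u) n) v =
  kappa u (series (exp_term (ad (- x)) v) n).
Proof.
rewrite /series /= linear_sumlz linear_sumr /=; apply: eq_bigr => i _.
rewrite /exp_term linearZl linearZr /=; congr (_ * _).
elim: i u v => // i IH u v.
by rewrite iterS iterSr kappa_ad IH.
Qed.

Lemma kappa_exp_ad x u v : kappa (exp_ad x u) v = kappa u (exp_ad (- x) v).
Proof.
have L : kappa (series (exp_term (ad x) u) n) v @[n --> \oo]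
    --> kappa (exp_ad x u) v.
  by apply: cvg_kappa; [exact: cvg_exp_ad|exact: cvg_cst].
have Rl : kappa u (series (exp_term (ad (- x)) v) n) @[n --> \oo]
    --> kappa u (exp_ad (- x) v).
  by apply: cvg_kappa; [exact: cvg_cst|exact: cvg_exp_ad].
rewrite -(cvg_lim (@Rhausdorff R) L) -(cvg_lim (@Rhausdorff R) Rl).
by under eq_fun do rewrite kappa_exp_partial.
Qed.

Lemma kappa_exp_ad_isometry x u v : kappa (exp_ad x u) (exp_ad x v) = kappa u v.
Proof.
have L := cvg_kappa _ _ _ _ (cvg_exp_ad x u) (cvg_exp_ad x v).
rewrite -(cvg_lim (@Rhausdorff R) L).
apply: (cvg_lim (@Rhausdorff R)).
under eq_fun do rewrite kappa_exp_partial.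
have [a a0 aP] := ad_bounded (- x).
apply: cvg_kappa; first exact: cvg_cst.
by apply: (cvg_series_exp_term_opp _ _ _ _ aP a0 (ad x)) => w /=; rewrite adN opprK.
Qed.

Lemma kappa_eq u v : (forall w, kappa u w = kappa v w) -> u = v.
Proof.
move=> uv; apply/eqP; rewrite -subr_eq0; apply/negPn/negP => /kappa_gt0.
by rewrite [kappa (u - v) _]linearBl /= uv subrr ltxx.
Qed.

(** The adjoint of an isometry is a left inverse of it, and [exp_ad (- x)] is an
    isometry whose adjoint is [exp_ad x]. *)
Lemma exp_adK x : cancel (exp_ad (- x)) (exp_ad x).
Proof.
move=> y; apply: kappa_eq => w.
by rewrite kappa_exp_ad kappa_exp_ad_isometry.
Qed.

(** Expanding the squared distance reduces this to the invariance of [kappa],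
    without recourse to the linearity of [exp_ad x]. *)
Lemma exp_ad_isometry x u v : `|exp_ad x u - exp_ad x v| = `|u - v|.
Proof.
apply/eqP; rewrite -(@eqrXn2 _ 2)//; apply/eqP.
by rewrite !sqr_norm_sub !kappa_exp_ad_isometry.
Qed.

Lemma exp_ad_norm x u : `|exp_ad x u| = `|u|.
Proof.
by apply/eqP; rewrite -(@eqrXn2 _ 2)// !norm_kappa kappa_exp_ad_isometry.
Qed.

(** Every [x] has a positive multiple whose [ad] has norm at most [1/2], and
    [exp_fixed_ker] applies to that multiple. *)
Lemma exp_ad_fixed_center z : (forall x, exp_ad x z = z) -> lie_center g z.
Proof.
move=> fix_z x.
have [a a0 aP] := ad_bounded x.
pose t := (2 * (a + 1))^-1.
have t0 : 0 < t by rewrite invr_gt0 mulr_gt0// ltr_pwDr.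
have tP v : `|ad (t *: x) v| <= 2^-1 * `|v|.
  rewrite /ad [bracket _ _]linearZl_LR /= normrZ gtr0_norm//.
  apply: (@le_trans _ _ (t * (a * `|v|))); first by rewrite ler_wpM2l ?(ltW t0) ?aP.
  rewrite mulrA ler_wpM2r// /t invfM -mulrA ger_pMr// mulrC ler_pdivrMr ?mul1r.
    by rewrite lerDl.
  by rewrite ltr_pwDr.
have : ad (t *: x) z = 0.
  apply: (exp_fixed_ker _ _ _ _ tP) => //; exact: fix_z.
rewrite /ad [bracket _ _]linearZl_LR /= => /eqP.
rewrite scaler_eq0 gt_eqF//= => /eqP xz.
have := bracket_alt (z + x).
by rewrite linearDl !linearDr /= !bracket_alt xz add0r !addr0.
Qed.

(** * Erosion of an open set *)

Definition erosion (e : R) Omega : set g := [set c | ball c e `<=` Omega].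

(** The balls are open, so a point of the ball around
    a limit of centres already lies in the ball around a nearby centre. *)
Lemma erosion_closed e Omega : closed (erosion e Omega).
Proof.
move=> c cc y; rewrite -ball_normE /= => cy.
have d0 : 0 < e - `|c - y| by rewrite subr_gt0.
have [c' [c'P]] := cc _ (nbhsx_ballx c (e - `|c - y|) d0).
rewrite -ball_normE /= => cc'; apply: c'P; rewrite -ball_normE /=.
have := ler_normD (c' - c) (c - y); rewrite subrKA (distrC c' c) => h.
by apply: le_lt_trans h _; rewrite -ltrBrDr.
Qed.

(** The ball around a midpoint consists of the midpoints of equal translates of
    the two end points. *)
Lemma erosion_midpoint e Omega : convex_set (M := g) Omega ->
  forall u v, erosion e Omega u -> erosion e Omega v ->
  erosion e Omega (2^-1 *: (u + v)).
Proof.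
move=> cvx u v uP vP y; rewrite -ball_normE /= => my.
pose d := y - 2^-1 *: (u + v).
have dP : `|d| < e by rewrite /d distrC.
have half0 : 0 <= 2^-1 :> R by rewrite invr_ge0.
have half1 : 2^-1 <= 1 :> R by rewrite invf_le1// ler1n.
have Oud : Omega (u + d).
  by apply: uP; rewrite -ball_normE /= opprD addNKr normrN.
have Ovd : Omega (v + d).
  by apply: vP; rewrite -ball_normE /= opprD addNKr normrN.
have := cvx (u + d) (v + d) (Itv01 half0 half1) (mem_set Oud) (mem_set Ovd).
rewrite inE; congr Omega.
rewrite [LHS](_ : _ = 2^-1 *: (u + d) + (1 - 2^-1) *: (v + d))//.
have -> : 1 - 2^-1 = 2^-1 :> R by field.
rewrite -scalerDr addrACA -mulr2n scalerDr -(scaler_nat 2 d) scalerA mulVf//.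
by rewrite scale1r /d addrCA subrr addr0.
Qed.

(** A point [y] of the ball around [exp_ad x c] is the image of
    [exp_ad (- x) y], which lies in the ball around [c]. *)
Lemma erosion_exp_ad e Omega : inner_invariant Omega ->
  forall x c, erosion e Omega c -> erosion e Omega (exp_ad x c).
Proof.
move=> inv x c cP y; rewrite -ball_normE /= => cy.
rewrite -(exp_adK x y); apply: (inv _ (inner_aut_exp x)).
exists (exp_ad (- x) y) => //; apply: cP; rewrite -ball_normE /=.
by rewrite -(exp_ad_isometry x) exp_adK.
Qed.

End hilbert_lie.

Theorem proposition6p11 (R : realType) (g : hilbertLieType R) (Omega : set g) :
  Omega !=set0 -> open Omega -> inner_invariant Omega ->
  convex_set (M := g) Omega ->
  Omega `&` lie_center g !=set0.

Proof.
move=> [x0 Ox0] Oo inv cvx.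
have /nbhs_ballP[e /= e0 eP] := open_nbhs_nbhs (conj Oo Ox0).
have mid := erosion_midpoint _ _ e _ cvx.
have [z Cz zmin] := closed_min_norm_exists _ _ (@hilbert_parallelogram R g) _
  mid (erosion_closed _ _ e Omega) (ex_intro _ x0 eP).
exists z; split; first by apply: Cz; exact: ballxx.
apply: exp_ad_fixed_center => x; apply/esym.
apply: (min_norm_unique _ _ (@hilbert_parallelogram R g) _ mid) => //.
  exact: erosion_exp_ad.
exact: exp_ad_norm.
Qed.
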